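(* Let $d=1$ and $\lambda>0$. Let $\mathcal{E}$ be a Poisson point process on $\mathbb{R}$ with intensity $\lambda\,\mathrm{Leb}_1$ and, conditionally on $\mathcal{E}$, let $\{(B^x_s)_{s\ge 0}: x\in\mathcal{E}\}$ be independent one-dimensional Brownian motions with $B^x_0=x$ (with $(B^x_s-x)_{s\geq 0}$ independent of $\mathcal{E}$). For $t\ge 0$ let $\mathcal{O}_t=\bigcup_{x\in\mathcal{E}}\{B^x_s: 0\le s\le t\}$. Then for every $t\ge 0$, almost surely $\mathcal{O}_t$ has no unbounded cluster.
   Context: Two points are connected in a set $A$ if there is a continuous path $\gamma:[0,1]\to A$ joining them; a cluster of $A$ is a maximal connected subset of $A$; a cluster is bounded if it is contained in some ball $\{y:\|y\|<R\}$, and unbounded otherwise. *)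

(* Defs.v *)
From HB Require Import structures.
From mathcomp Require Import all_boot all_order all_algebra.
From mathcomp Require Import all_classical all_reals all_analysis.
Set Implicit Arguments. Unset Strict Implicit. Unset Printing Implicit Defensive.
Import Order.TTheory GRing.Theory Num.Theory.
Import numFieldNormedType.Exports.
Local Open Scope classical_set_scope.
Local Open Scope ring_scope.

Section Defs.
Context {R : realType} {d : measure_display} {Omega : measurableType d}.
Variable P : probability Omega R.

Definition mutually_independent (I : eqType) (F : I -> set (set Omega)) : Prop :=
  forall (J : seq I) (A : I -> set Omega),
    uniq J -> (forall i, i \in J -> F i (A i)) ->
    P (\bigcap_(i in [set` J]) A i) = (\prod_(i <- J) P (A i))%E.

Definition gen_sigma (K : Type) (f : K -> Omega -> R) : set (set Omega) :=
  <<s [set A | exists k (B : set R), measurable B /\ A = f k @^-1` B] >>.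

Definition standard_BM (W : R -> Omega -> R) : Prop :=
  (forall s, 0 <= s -> measurable_fun setT (W s)) /\
  (forall w, W 0 w = 0) /\
  {ae P, forall w, {within `[0, +oo[, continuous (fun s => W s w)}} /\
  (forall s t (B : set R), 0 <= s -> s < t -> measurable B ->
     P ((fun w => W t w - W s w) @^-1` B) = normal_prob 0 (Num.sqrt (t - s)) B) /\
  (forall ts : seq R, 0 <= head 0 ts -> sorted <%R ts ->
     mutually_independent
       (fun i : 'I_(size ts).-1 => gen_sigma (fun _ : unit => fun w =>
           W (nth 0 ts i.+1) w - W (nth 0 ts i) w))).

(* the labels n with X n w in A form a finite set of exactly k labels,
   i.e. the point process puts exactly k points in A *)
Definition count_is (X : nat -> Omega -> R) (A : set R) (k : nat) : set Omega :=
  [set w | exists s : seq nat, [/\ uniq s, size s = k &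
             forall n, A (X n w) <-> n \in s]].

Definition bounded_real_set (A : set R) : Prop :=
  exists M : R, forall x, A x -> `|x| <= M.

(* (X n)_n enumerates the points of a Poisson point process on R with
   intensity lam * Lebesgue *)
Definition poisson_pp (lam : R) (X : nat -> Omega -> R) : Prop :=
  (forall n, measurable_fun setT (X n)) /\
  (forall (A : set R) (k : nat), measurable A -> bounded_real_set A ->
     P (count_is X A k) =
     (expR (- (lam * fine (lebesgue_measure A))) *
      (lam * fine (lebesgue_measure A)) ^+ k / (factorial k)%:R)%:E) /\
  (forall (m : nat) (A : 'I_m -> set R) (k : 'I_m -> nat),
     (forall i, measurable (A i) /\ bounded_real_set (A i)) ->
     (forall i j, i != j -> A i `&` A j = set0) ->
     P (\bigcap_(i in [set: 'I_m]) count_is X (A i) (k i)) =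
     (\prod_(i < m) P (count_is X (A i) (k i)))%E).

Definition BM_from_points (X : nat -> Omega -> R) (B : nat -> R -> Omega -> R) : Prop :=
  (forall n w, B n 0 w = X n w) /\
  (forall n, standard_BM (fun s w => B n s w - X n w)) /\
  mutually_independent
    (fun o : option nat => match o with
       | None => gen_sigma X
       | Some n => gen_sigma (fun s : {s : R | 0 <= s} => fun w => B n (sval s) w - X n w)
       end).

End Defs.

Section Geom.
Context {R : realType}.

Definition occupied {Omega : Type} (B : nat -> R -> Omega -> R) (t : R) (w : Omega) : set R :=
  [set y | exists n s, [/\ 0 <= s, s <= t & y = B n s w]].

Definition connected_in (A : set R) (x y : R) : Prop :=
  exists g : R -> R, [/\ {within `[0, 1], continuous g}, g 0 = x, g 1 = y &
                        forall u, 0 <= u <= 1 -> A (g u)].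

Definition path_connected_set (C : set R) : Prop :=
  forall x y, C x -> C y -> connected_in C x y.

Definition cluster_of (A C : set R) : Prop :=
  [/\ C `<=` A, path_connected_set C &
      forall D, C `<=` D -> D `<=` A -> path_connected_set D -> D = C].

Definition bounded_cluster (C : set R) : Prop :=
  exists M : R, forall y, C y -> `|y| < M.

End Geom.

(* Main.v *)
(** Fix a large radius [r] and cut a long stretch of the line into disjoint windows of radius
    [r]. A particle starting outside a window must travel at least [r] to reach its centre, so a
    union bound over the Poisson points (mean measure) and the Gaussian tails of Brownian maxima
    shows that the centre is hit from outside with probability [O(exp (- alpha r^2))]. A window is
    empty with the much larger probability [exp (- 2 lam r)], independently of the others. With
    about [exp ((2 lam + 1) r)] windows, some window is therefore empty and its centre uncovered,
    except with probability tending to [0] as [r] grows. Hence almost surely there are uncovered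
    points arbitrarily far to the right and to the left, and a path-connected subset of the line
    cannot cross them.

    The maxima are controlled by dyadic chaining, which needs only the law of the increments and
    the continuity of the paths, not the independence of the increments. *)
Require Import Defs.
From HB Require Import structures.
From mathcomp Require Import all_boot all_order all_algebra.
From mathcomp Require Import all_classical all_reals all_analysis measurable_realfun.
From mathcomp Require Import ring lra.
Set Implicit Arguments.
Unset Strict Implicit.
Import Order.TTheory GRing.Theory Num.Theory.
Import numFieldNormedType.Exports.
Local Open Scope classical_set_scope.
Local Open Scope ring_scope.

(** * Union bounds and counting with multiplicity *)

Section measure_bounds.
Context {R : realType} {d : measure_display} {T : measurableType d}.
Variable P : {measure set T -> \bar R}.

Lemma measure_bigcup_geometric (F : nat -> set T) (c : R) : 0 <= c ->
  (forall k, measurable (F k)) ->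
  (forall k, P (F k) <= (c / (2 ^ k.+1)%:R)%:E)%E ->
  (P (\bigcup_k F k) <= c%:E)%E.
Proof.
move=> c0 mF PF; apply: (@le_trans _ _ (\sum_(k <oo) P (F k))%E).
  by apply: measure_sigma_subadditive => //; exact: bigcup_measurable.
apply: le_trans (epsilon_trick0 xpredT c0).
by apply: lee_nneseries => // k _; exact: PF.
Qed.

(** Integrate over [C] the number of indices [n] with [E n w]: pointwise it is at most the length
    [m] of the list [s]. This later bounds the expected number of Poisson points on the event that
    the count is [m]. *)
Lemma sum_measure_le_multiplicity (E : nat -> set T) (C : set T) (m : nat) :
  (forall n, measurable (E n)) -> measurable C ->
  (forall w, C w -> exists2 s : seq nat, size s = m & forall n, E n w -> n \in s) ->
  (\sum_(n <oo) P (E n `&` C) <= m%:R%:E * P C)%E.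
Proof.
move=> mE mC hC; apply: lime_le; first exact: is_cvg_nneseries.
apply: nearW => K.
have -> : (\sum_(0 <= n < K) P (E n `&` C) =
   \sum_(0 <= n < K) \int[P]_(w in C) (\1_(E n) w)%:E)%E.
  by apply: eq_bigr => n _; rewrite integral_indic.
rewrite -ge0_integral_sum//; last first.
  by move=> n; apply/measurable_EFinP; exact: measurable_indic.
rewrite -integral_cst//; apply: ge0_le_integral => //.
- by move=> w _; apply: sume_ge0.
- apply: emeasurable_sum => n; apply/measurable_EFinP.
  by apply: measurable_funTS; exact: measurable_indic.
- move=> w Cw; rewrite sumEFin lee_fin.
  have [s <- hs] := hC w Cw.
  rewrite (eq_bigr (fun n => (n%N \in [set n | E n w])%:R)); last first.
    by move=> n _; rewrite indicE; congr (_ %:R); congr nat_of_bool; apply/idP/idP; rewrite !inE.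
  rewrite -natr_sum ler_nat.
  rewrite -big_mkcond/= sum1_count -size_filter; apply: uniq_leq_size.
    by rewrite filter_uniq// iota_uniq.
  by move=> n; rewrite mem_filter => /andP[]; rewrite inE/= => /hs.
Qed.

End measure_bounds.

(** * Gaussian tails *)

Section normal_tail.
Context {R : realType}.
Implicit Types (s c rho : R) (V : set R).

(** The sign condition gives [x^2 >= c^2 + (x - c)^2] on [V], so there the density centred at [0] is
    at most the exponential factor times the density centred at [c], whose total mass is [1]. The
    condition covers the half-line beyond [c] for either sign of [c]. *)
Lemma normal_prob_halfline_le s c V : 0 < s -> measurable V ->
  (forall x, V x -> 0 <= c * (x - c)) ->
  (normal_prob 0 s V <= (expR (- (c ^+ 2 / (s ^+ 2 *+ 2))))%:E)%E.
Proof.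
move=> s0 mV hV.
have s1 : s != 0 by rewrite gt_eqF.
apply: (@le_trans _ _ ((expR (- (c ^+ 2 / (s ^+ 2 *+ 2))))%:E * normal_prob c s V)%E).
  rewrite /normal_prob -ge0_integralZl//; last 2 first.
  - apply/measurable_EFinP; apply: measurable_funTS.
    exact: measurable_normal_pdf.
  - by move=> x _; rewrite lee_fin normal_pdf_ge0.
  apply: ge0_le_integral => //.
  - by move=> x _; rewrite lee_fin normal_pdf_ge0.
  - apply/measurable_EFinP; apply: measurable_funTS.
    exact: measurable_normal_pdf.
  - apply/measurable_EFinP; apply: measurable_funM => //.
    by apply: measurable_funTS; exact: measurable_normal_pdf.
  - move=> x Vx; rewrite -EFinM lee_fin !normal_pdfE// mulrCA ler_wpM2l ?normal_peak_ge0//.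
    rewrite /normal_fun -expRD ler_expR -!mulNr -mulrDl ler_wpM2r//.
      by rewrite invr_ge0 mulrn_wge0// sqr_ge0.
    by have := hV x Vx; lra.
rewrite -[leRHS]mule1 lee_wpmul2l ?lee_fin ?expR_ge0//.
exact: probability_le1.
Qed.

Lemma normal_prob_tail s rho : 0 < s -> 0 <= rho ->
  (normal_prob 0 s [set x : R | (rho <= `|x|)%R] <=
   (2 * expR (- (rho ^+ 2 / (s ^+ 2 *+ 2))))%:E)%E.
Proof.
move=> s0 r0.
have -> : [set x : R | rho <= `|x|] = `[rho, +oo[ `|` `]-oo, (- rho)].
  apply/seteqP; split => x /=; rewrite !in_itv/= andbT.
    by rewrite lerNr real_ler_normr ?num_real// => /orP.
  by rewrite lerNr real_ler_normr ?num_real// => /orP.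
apply: (le_trans (measureU2 _ _ _)) => //.
rewrite mulr_natl mulr2n EFinD; apply: leeD.
  apply: normal_prob_halfline_le => // x /=; rewrite in_itv/= andbT => hx.
  by rewrite mulr_ge0// subr_ge0.
rewrite -sqrrN; apply: normal_prob_halfline_le => // x /=; rewrite in_itv/= => hx.
have : 0 <= rho * (- x - rho) by rewrite mulr_ge0//; lra.
by lra.
Qed.

End normal_tail.

(** * Deterministic dyadic chaining *)

Section chaining.
Context {R : realType}.

(** Induction on the level: an odd grid point of level [j+1] is one increment away from an even one,
    which belongs to level [j]. The bound is the geometric sum of [a (3/4)^k] over [k <= j]. *)
Lemma dyadic_chaining_grid (W : R -> R) (T a : R) : W 0 = 0 ->
  (forall j i, (i < 2 ^ j)%N ->
    `|W (T * i.+1%:R / 2 ^+ j) - W (T * i%:R / 2 ^+ j)| <= a * (3 / 4) ^+ j) ->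
  forall j i, (i <= 2 ^ j)%N ->
    `|W (T * i%:R / 2 ^+ j)| <= 4 * a * (1 - (3 / 4) ^+ j.+1).
Proof.
move=> W0 hW.
have a0 : 0 <= a by have := hW 0%N 0%N isT; rewrite !expr0 [a * _]mulr1 => /(le_trans (normr_ge0 _)).
elim=> [|j IH] i.
  case: i => [|[|//]] _; first by rewrite mulr0 mul0r W0 normr0; lra.
  by have := hW 0%N 0%N isT; rewrite !expr0 expr1 mulr0 mul0r W0 subr0; lra.
move=> ij.
have even m : (m <= 2 ^ j)%N ->
    `|W (T * m.*2%:R / 2 ^+ j.+1)| <= 4 * a * (1 - (3 / 4) ^+ j.+1).
  move=> mj; have -> : T * m.*2%:R / 2 ^+ j.+1 = T * m%:R / 2 ^+ j :> R.
    rewrite -muln2 natrM exprS; field.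
    by rewrite expf_neq0.
  exact: IH.
have q0 : 0 <= (3 / 4) ^+ j.+1 :> R by rewrite exprn_ge0//; lra.
rewrite [(3 / 4) ^+ j.+2]exprS.
have [oi|ei] := boolP (odd i).
  have iE : i = i./2.*2.+1 by rewrite -[LHS]odd_double_half oi.
  have mj : (i./2 < 2 ^ j)%N by rewrite -ltn_double -iE -mul2n -expnS.
  rewrite iE.
  have h1 := even _ (ltnW mj).
  have h2 : `|W (T * i./2.*2.+1%:R / 2 ^+ j.+1) - W (T * i./2.*2%:R / 2 ^+ j.+1)|
      <= a * (3 / 4) ^+ j.+1.
    by apply: hW; rewrite -iE.
  rewrite -[X in `|X|](subrK (W (T * i./2.*2%:R / 2 ^+ j.+1))).
  apply: le_trans (ler_normD _ _) _; apply: le_trans (lerD h2 h1) _.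
  by move: ((3 / 4) ^+ j.+1) q0 => q q0; nra.
have iE : i = i./2.*2 by rewrite -[LHS]odd_double_half (negbTE ei).
rewrite iE; apply: le_trans (even _ _) _.
  by rewrite -leq_double -iE -mul2n -expnS.
by move: ((3 / 4) ^+ j.+1) q0 => q q0; nra.
Qed.

(** The grid bounds stay below [4 a] at every level, and grid points approximate [s], so continuity
    at [s] carries the bound over. *)
Lemma dyadic_chaining (W : R -> R) (T a : R) : 0 < T -> W 0 = 0 ->
  {within `[0, +oo[, continuous W} ->
  (forall j i, (i < 2 ^ j)%N ->
    `|W (T * i.+1%:R / 2 ^+ j) - W (T * i%:R / 2 ^+ j)| <= a * (3 / 4) ^+ j) ->
  forall s, 0 <= s <= T -> `|W s| <= 4 * a.
Proof.
move=> T0 W0 cW hW s /andP[s0 sT].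
have a0 : 0 <= a by have := hW 0%N 0%N isT; rewrite !expr0 [a * _]mulr1 => /(le_trans (normr_ge0 _)).
rewrite leNgt; apply/negP => lt_aW.
have e0 : 0 < `|W s| - 4 * a by lra.
have As : `[0, +oo[%classic s by rewrite /= in_itv/= s0.
have /subspace_continuousP/(_ s As)/cvgrPdist_lt/(_ _ e0) := cW.
rewrite near_withinE => /nbhs_ballP[e /= e_gt0 he].
have [j jP] : exists j : nat, T / 2 ^+ j < e.
  have [j jP] : exists j : nat, T / e < j%:R.
    exists (Num.truncn (T / e)).+1.
    by apply: (lt_le_trans (truncnS_gt _)).
  exists j; rewrite ltr_pdivrMr ?exprn_gt0// mulrC -ltr_pdivrMr//.
  apply: lt_le_trans jP _; rewrite -natrX ler_nat; exact/ltnW/ltn_expl.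
have p0 : 0 < 2 ^+ j :> R by rewrite exprn_gt0.
(* Rounding down gives the last grid point at or before [s], within [T / 2^j < e] of it. *)
pose i := Num.truncn (s / T * 2 ^+ j).
have h0 : 0 <= s / T * 2 ^+ j by rewrite mulr_ge0 ?divr_ge0 ?(ltW T0) ?(ltW p0).
have /andP[i1 i2] := truncn_itv h0.
have ij : (i <= 2 ^ j)%N.
  rewrite -(ler_nat R) (le_trans i1)// natrX ler_piMl ?(ltW p0)//.
  by rewrite ler_pdivrMr// mul1r.
have := dyadic_chaining_grid W0 hW ij.
set u := T * i%:R / 2 ^+ j.
have u0 : 0 <= u by rewrite /u divr_ge0 ?mulr_ge0 ?ler0n ?ltW.
have us : `|s - u| < e.
  apply: le_lt_trans jP.
  have sE : s = T * (s / T * 2 ^+ j) / 2 ^+ j by field; rewrite !gt_eqF.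
  rewrite {1}sE /u -mulrBl -mulrBr normrM normrM (gtr0_norm T0).
  rewrite (gtr0_norm (x := (2 ^+ j)^-1)) ?invr_gt0// ler_wpM2r ?invr_ge0 ?(ltW p0)//.
  rewrite ler_piMr ?(ltW T0)// ger0_norm ?subr_ge0//.
  by rewrite ltW// ltrBlDl natr1.
have := he u us; rewrite /= in_itv/= u0 => /(_ isT) h1 h2.
have h3 : `|W s| <= `|W s - W u| + `|W u| by rewrite -{1}(subrK (W u) (W s)) ler_normD.
have q0 : 0 <= (3 / 4) ^+ j.+1 :> R by rewrite exprn_ge0//; lra.
by move: ((3 / 4) ^+ j.+1) q0 h2 => q q0 h2; nra.
Qed.

End chaining.

(** * Maximal displacement of a Brownian path *)

Section large_increment.
Context {R : realType}.

(** The factor [3/4] keeps the thresholds summable, yet exceeds [1 / sqrt 2], the rate at which the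
    standard deviation of the increments shrinks from one level to the next. *)
Definition large_increment {Omega : Type} (W : R -> Omega -> R) (T a : R) : set Omega :=
  \bigcup_j \bigcup_(i < 2 ^ j)
    [set w | a * (3 / 4) ^+ j <= `|W (T * i.+1%:R / 2 ^+ j) w - W (T * i%:R / 2 ^+ j) w|].

Lemma not_large_increment_le {Omega : Type} (W : R -> Omega -> R) (T a : R) w :
  0 < T -> W 0 w = 0 -> {within `[0, +oo[, continuous (fun s => W s w)} ->
  ~ large_increment W T a w -> forall s, 0 <= s <= T -> `|W s w| <= 4 * a.
Proof.
move=> T0 W0 cW nW; apply: (dyadic_chaining T0 W0 cW) => j i ij.
rewrite leNgt; apply/negP => lt_aW; apply: nW.
by exists j => //; exists i => //=; exact: ltW.
Qed.

Lemma measurable_norm_ge (a : R) : measurable [set x : R | a <= `|x|].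
Proof.
rewrite (_ : [set x | _] = setT `&` (fun x => `|x|) @^-1` `[a, +oo[%classic).
  exact: normr_measurable.
by apply/seteqP; split => x /=; rewrite in_itv/= andbT// => -[].
Qed.

Lemma measurable_increment d (Omega : measurableType d) (W : R -> Omega -> R) (u v a : R) :
  measurable_fun setT (W u) -> measurable_fun setT (W v) ->
  measurable [set w | a <= `|W u w - W v w|].
Proof.
move=> mu mv.
have := measurable_funB mu mv measurableT (measurable_norm_ge a).
by rewrite setTI.
Qed.

Lemma measurable_large_increment d (Omega : measurableType d) (W : R -> Omega -> R) (T a : R) :
  0 <= T -> (forall s, 0 <= s -> measurable_fun setT (W s)) ->
  measurable (large_increment W T a).
Proof.
move=> T0 mW; apply: bigcup_measurable => j _; apply: bigcup_measurable => i _.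
by apply: measurable_increment; apply: mW; rewrite divr_ge0 ?mulr_ge0 ?exprn_ge0.
Qed.

(** Measurability is applied on [Omega] equipped with the sigma-algebra generated by the path, which
    puts the event within reach of the independence hypothesis. *)
Lemma gen_sigma_large_increment d (Omega : measurableType d) (W : R -> Omega -> R) (T a : R) :
  0 <= T ->
  gen_sigma (fun s : {s : R | 0 <= s} => W (sval s)) (large_increment W T a).
Proof.
move=> T0; rewrite /gen_sigma; set G := [set A | _].
apply: (@measurable_large_increment _ (g_sigma_algebraType G)) => // s s0 _ B mB.
rewrite setTI; apply: sub_sigma_algebra.
by exists (exist _ s s0), B.
Qed.

(* [K] is the exponent of the Gaussian tail at the coarsest scale [j = 0]; at scale [j] it
   becomes [K (9/8)^j], which beats the [2^j] increments of that scale. *)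
Lemma prob_large_increment d (Omega : measurableType d) (P : probability Omega R)
    (W : R -> Omega -> R) (T a : R) (K := a ^+ 2 / (2 * T)) :
  standard_BM P W -> 0 < T -> 0 <= a -> 24 <= K ->
  (P (large_increment W T a) <= (4 * expR (- K))%:E)%E.
Proof.
move=> [mW [_ [_ [gW _]]]] T0 a0 K24.
have grid0 j (i : nat) : 0 <= T * i%:R / 2 ^+ j.
  by rewrite divr_ge0 ?mulr_ge0 ?exprn_ge0 ?(ltW T0).
have mI j i : measurable
    [set w | a * (3 / 4) ^+ j <= `|W (T * i.+1%:R / 2 ^+ j) w - W (T * i%:R / 2 ^+ j) w|].
  by apply: measurable_increment; apply: mW.
apply: measure_bigcup_geometric.
- by rewrite mulr_ge0 ?expR_ge0.
- by move=> j; apply: bigcup_measurable.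
move=> j; rewrite bigcup_mkord.
apply: le_trans (Boole_inequality P (fun i _ => mI j i)) _.
have p0 : 0 < 2 ^+ j :> R by rewrite exprn_gt0.
have I_le i : (P [set w | (a * (3 / 4) ^+ j <=
      `|W (T * i.+1%:R / 2 ^+ j) w - W (T * i%:R / 2 ^+ j) w|)%R] <=
    (2 * expR (- (K * (9 / 8) ^+ j)))%:E)%E.
  have step : T * i.+1%:R / 2 ^+ j - T * i%:R / 2 ^+ j = T / 2 ^+ j.
    by rewrite -mulrBl -mulrBr -natr1 [_ + 1]addrC addrK mulr1.
  have := gW (T * i%:R / 2 ^+ j) (T * i.+1%:R / 2 ^+ j)
    [set x : R | (a * (3 / 4) ^+ j <= `|x|)%R] (grid0 _ _).
  rewrite step -subr_gt0 step divr_gt0// => /(_ isT) -> //; last exact: measurable_norm_ge.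
  apply: le_trans (normal_prob_tail _ _) _.
  - by rewrite sqrtr_gt0 divr_gt0.
  - by rewrite mulr_ge0// exprn_ge0//; lra.
  rewrite lee_fin ler_wpM2l// ler_expR lerN2 le_eqVlt; apply/orP; left; apply/eqP.
  rewrite sqr_sqrtr ?divr_ge0 ?(ltW T0) ?(ltW p0)//.
  have -> : (9 / 8) ^+ j = (3 / 4) ^+ j * (3 / 4) ^+ j * 2 ^+ j :> R.
    by rewrite -!exprMn; congr (_ ^+ _); field.
  rewrite /K; field.
  by rewrite !gt_eqF.
apply: (@le_trans _ _ (\sum_(i < 2 ^ j) (2 * expR (- (K * (9 / 8) ^+ j)))%:E)%E).
  by apply: lee_sum => i _; exact: I_le.
rewrite sumEFin lee_fin sumr_const card_ord -[_ *+ (2 ^ j)%N]mulr_natl !natrX.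
rewrite ler_pdivlMr ?exprn_gt0// exprS.
(* Bernoulli's inequality turns the exponent [K (9/8)^j] into at least [K + j K / 8]. *)
have Bern : 1 + j%:R / 8 <= (9 / 8) ^+ j :> R.
  elim: j {p0 I_le} => [|j IH]; first by rewrite expr0; lra.
  rewrite exprS -natr1; have : 0 <= j%:R :> R by []; lra.
(* From [K >= 24], [expR (K / 8) >= 1 + K / 8 >= 4]. The resulting [4^-j] pays for the [2^j]
   increments and for the geometric weight of level [j]. *)
have e4 : (4 * expR (- (K / 8))) ^+ j <= 1.
  apply: exprn_ile1; first by rewrite mulr_ge0 ?expR_ge0.
  rewrite expRN ler_pdivrMr ?expR_gt0// mul1r.
  by apply: le_trans (expR_ge1Dx _); lra.
have e5 : expR (- (K * (9 / 8) ^+ j)) <= expR (- K) * expR (- (K / 8)) ^+ j.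
  by rewrite -expRM_natl -expRD ler_expR; nra.
move: e4; rewrite exprMn (_ : 4 ^+ j = 2 ^+ j * 2 ^+ j); last first.
  by rewrite -exprMn; congr (_ ^+ _); ring.
have := expR_ge0 (- K).
move: e5 p0; move: (expR (- (K * _))) (expR (- K)) (expR (- (K / 8)) ^+ j) (2 ^+ j) => x y z q xyz q0 y0 qz.
have : q * q * x <= q * q * (y * z) by rewrite ler_wpM2l// mulr_ge0// ltW.
have : q * q * z * y <= y by rewrite ler_piMl.
lra.
Qed.

End large_increment.

(** * Counts of Poisson points: mean measure and empty windows *)

Section poisson_counts.
Context {R : realType} {d : measure_display} {Omega : measurableType d}.
Variable P : probability Omega R.
Implicit Types (X : nat -> Omega -> R) (A : set R).

Lemma measurable_preimageT d' (U : measurableType d') (f : Omega -> U) (B : set U) :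
  measurable_fun setT f -> measurable B -> measurable (f @^-1` B).
Proof. by move=> mf mB; rewrite -[_ @^-1` _]setTI; exact: mf. Qed.

(** There are countably many finite lists of labels, enumerated by [unpickle]; for each one, having
    exactly these labels in [A] is a countable intersection. *)
Lemma measurable_count_is X A k :
  (forall n, measurable_fun setT (X n)) -> measurable A ->
  measurable (count_is X A k).
Proof.
move=> mX mA.
pose F (s : seq nat) := if uniq s && (size s == k) then
  \bigcap_n (if n \in s then X n @^-1` A else ~` (X n @^-1` A)) else set0.
have mF s : measurable (F s).
  rewrite /F; case: ifP => // _; apply: bigcap_measurable => // n _.
  have mn : measurable (X n @^-1` A) by exact: measurable_preimageT.
  by case: ifP => // _; exact: measurableC.
have -> : count_is X A k = \bigcup_i oapp F set0 (unpickle i).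
  apply/seteqP; split => [w [s [us sk hs]]|w [i _]].
    exists (pickle s) => //; rewrite pickleK /= /F us sk eqxx => n _.
    by case: ifP => [/hs//|/negP ns /hs].
  case: (unpickle i) => //= s; rewrite /F; case: ifP => // /andP[us /eqP sk] h.
  exists s; split => // n; have := h n I.
  by case: ifP => // ns hA; split.
apply: bigcup_measurable => i _.
by case: (unpickle i) => [s|] /=; [exact: mF | exact: measurable0].
Qed.

Lemma trivIset_count_is X A : trivIset setT (count_is X A).
Proof.
apply/trivIsetP => i j _ _ ij; apply/seteqP; split => // w [[s [us si hs]] [r [ur rj hr]]].
apply/negP: ij; rewrite negbK -si -rj; apply/eqP/perm_size/uniq_perm => // n.
by apply/idP/idP => /[dup] ? => [/hs/hr|/hr/hs].
Qed.

(** The sum is the expected number of points in [A]. Splitting by the value [k] of the count bounds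
    it by the mean of the Poisson law. *)
Lemma poisson_pp_mean_le (lam : R) X A :
  poisson_pp P lam X -> measurable A -> bounded_real_set A ->
  0 < lam * fine (lebesgue_measure A) ->
  (\sum_(n <oo) P (X n @^-1` A) <= (lam * fine (lebesgue_measure A))%:E)%E.
Proof.
move=> [mX [cX _]] mA bA; set mu := lam * _ => mu0.
have mC k : measurable (count_is X A k) by exact: measurable_count_is.
have mE n : measurable (X n @^-1` A) by exact: measurable_preimageT.
have PC k : P (count_is X A k) = (poisson_pmf mu k)%:E.
  by rewrite cX// /poisson_pmf mu0 -/mu; congr EFin; ring.
(* The Poisson weights sum to [1], so almost surely the count is finite. *)
have PU : (P (~` (\bigcup_k count_is X A k)) = 0)%E.
  rewrite probability_setC; last exact: bigcup_measurable.
  rewrite measure_bigcup//; last exact: trivIset_count_is.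
  under eq_eseriesl do rewrite in_setT.
  rewrite (eq_eseriesr (fun k _ => PC k)).
  have : (poisson_prob mu 0%N setT = 1)%E by exact: probability_setT.
  rewrite /poisson_prob mu0 -nneseries_esumT; last first.
    by move=> k; rewrite lee_fin poisson_pmf_ge0.
  by move=> ->; rewrite subee.
have PE n : (P (X n @^-1` A) = \sum_(k <oo) P (X n @^-1` A `&` count_is X A k))%E.
  have mU : measurable (\bigcup_k count_is X A k) by exact: bigcup_measurable.
  rewrite (measureDI P (mE n) mU) setDE.
  rewrite (@subset_measure0 _ _ _ P _ (~` (\bigcup_k count_is X A k))) ?add0e//; last 2 first.
  - by apply: measurableI => //; exact: measurableC.
  - exact: measurableC.
  rewrite setI_bigcupr; transitivity
    (\sum_(k <oo | k \in [set: nat]) P (X n @^-1` A `&` count_is X A k))%E.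
    apply: measure_bigcup => [k _|]; first exact: measurableI.
    exact/trivIset_setIl/trivIset_count_is.
  by apply: eq_eseriesl => k; rewrite in_setT.
rewrite (eq_eseriesr (fun n _ => PE n)) nneseries_interchange//.
apply: (@le_trans _ _ (\sum_(k <oo) (k%:R%:E * P (count_is X A k)))%E).
  apply: lee_nneseries => [k _ _|k _]; first exact: nneseries_ge0.
  apply: sum_measure_le_multiplicity => // w [s [_ sk hs]].
  by exists s => // n /hs.
apply: lime_le.
  by apply: is_cvg_nneseries => k _ _; rewrite mule_ge0.
apply: nearW => -[|K]; first by rewrite big_geq// lee_fin ltW.
rewrite big_nat_recl// mul0e add0e.
(* The Poisson weights satisfy [(k+1) p_(k+1) = mu p_k]. *)
have -> : (\sum_(0 <= k < K) (k.+1%:R%:E * P (count_is X A k.+1)) =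
           mu%:E * \sum_(0 <= k < K) P (count_is X A k))%E.
  rewrite ge0_sume_distrr//; apply: eq_bigr => k _.
  rewrite !PC -!EFinM; congr EFin; rewrite /poisson_pmf mu0 factS natrM exprS; field.
  by rewrite nat1r !pnatr_eq0 -lt0n fact_gt0.
rewrite -[leRHS]mule1 lee_wpmul2l ?lee_fin ?(ltW mu0)//.
rewrite big_mkord -measure_bigsetU//; last exact/sub_trivIset/trivIset_count_is.
by apply: probability_le1; exact: bigsetU_measurable.
Qed.

(** Product formulas pass to complements one event at a time: remove from [S] and [T] the part
    inside [E j]. That part has [j] moved to the list [s], so the induction must run over all
    [s]. *)
Lemma prob_bigcap_setC (E : nat -> set Omega) (p : R) :
  (forall i, measurable (E i)) ->
  (forall s, uniq s -> P (\big[setI/setT]_(i <- s) E i) = (p ^+ size s)%:E) ->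
  forall t s, uniq (t ++ s) ->
    P (\big[setI/setT]_(i <- s) E i `&` \big[setI/setT]_(i <- t) ~` E i) =
    (p ^+ size s * (1 - p) ^+ size t)%:E.
Proof.
move=> mE PE; elim=> [s us|j t IH s].
  by rewrite big_nil setIT PE// expr0 mulr1.
rewrite /= => /andP[js us].
have mI (F : nat -> set Omega) r : (forall i, measurable (F i)) ->
    measurable (\big[setI/setT]_(i <- r) F i).
  by move=> mF; apply: (big_ind measurable) => //; exact: measurableI.
have mC i : measurable (~` E i) by exact: measurableC.
set S := \big[setI/setT]_(i <- s) E i; set T := \big[setI/setT]_(i <- t) ~` E i.
rewrite big_cons setICA setIC -/T -setDE.
have mST : measurable (S `&` T) by apply: measurableI; exact: mI.
have -> : (P ((S `&` T) `\` E j) = P (S `&` T) - P (S `&` T `&` E j))%E.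
  by apply: measureD => //; rewrite -ge0_fin_numE// fin_num_measure.
have := IH (j :: s); rewrite big_cons -/S -/T -setIA setIC => ->; last first.
  by rewrite -(perm_uniq (_ : perm_eq (j :: t ++ s) _)) /= ?js// -cat1s -[j :: s]cat1s perm_catCA.
rewrite IH// -EFinB; congr EFin; rewrite /= !exprS; ring.
Qed.

Lemma poisson_pp_no_empty (lam p : R) X (A : nat -> set R) :
  poisson_pp P lam X ->
  (forall i, measurable (A i)) -> (forall i, bounded_real_set (A i)) ->
  (forall i j, i != j -> A i `&` A j = set0) ->
  (forall i, expR (- (lam * fine (lebesgue_measure (A i)))) = p) ->
  forall N, P (\bigcap_(i < N) ~` count_is X (A i) 0) = ((1 - p) ^+ N)%:E.
Proof.
move=> [mX [cX iX]] mA bA dA pA N.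
have PE i : P (count_is X (A i) 0) = p%:E.
  by rewrite cX// expr0 mulr1 fact0 invr1 mulr1 pA.
have := @prob_bigcap_setC (fun i => count_is X (A i) 0) p _ _ (iota 0 N) [::].
rewrite big_nil setTI cats0 iota_uniq mul1r size_iota => <- //.
- rewrite bigcap_mkord -(big_mkord xpredT (fun i => ~` count_is X (A i) 0)).
  by rewrite /index_iota subn0.
- by move=> i; exact: measurable_count_is.
move=> s us.
(* Independence is stated for families indexed by ordinals; positions in [s] serve as indices. *)
have := iX (size s) (fun i => A (nth 0%N s i)) (fun=> 0%N).
rewrite (eq_bigr (fun=> p%:E)) => [|i _]; last exact: PE.
rewrite prodEFin prodr_const card_ord => <-.
- congr (P _); rewrite -bigcap_seq; apply/seteqP; split => w h.
    by move=> i _; apply: h; rewrite /= mem_nth.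
  move=> i /= si; have /(nthP 0%N)[k ks <-] := si.
  exact: (h (Ordinal ks) I).
- by move=> i; split.
- by move=> i j ij; apply: dA; rewrite nth_uniq.
Qed.

End poisson_counts.

(** * Uncovered points in long intervals *)

Section uncovered_points.
Context {R : realType} {d : measure_display} {Omega : measurableType d}.
Variables (P : probability Omega R) (lam : R).
Variables (X : nat -> Omega -> R) (B : nat -> R -> Omega -> R).
Hypotheses (lam0 : 0 < lam) (ppX : poisson_pp P lam X) (BX : BM_from_points P X B).

Let W n s w := B n s w - X n w.

Definition large_move (A : set R) (T a : R) : set Omega :=
  \bigcup_n (X n @^-1` A `&` large_increment (W n) T a).

Lemma measurable_large_move A T a : 0 <= T -> measurable A ->
  measurable (large_move A T a).
Proof.
move=> T0 mA; apply: bigcup_measurable => n _; apply: measurableI.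
  by apply: measurable_preimageT => //; exact: ppX.1.
by apply: measurable_large_increment => // s s0; exact: (BX.2.1 n).1.
Qed.

(** Union bound over the labels: independence of start and displacement factors each term, and the
    starting probabilities sum to at most [lam], since [A] has length [1]. *)
Lemma prob_large_move A T a (K := a ^+ 2 / (2 * T)) :
  measurable A -> bounded_real_set A -> (lebesgue_measure A = 1)%E ->
  0 < T -> 0 <= a -> 24 <= K ->
  (P (large_move A T a) <= (lam * (4 * expR (- K)))%:E)%E.
Proof.
move=> mA bA A1 T0 a0 K24.
have mX n : measurable (X n @^-1` A).
  by apply: measurable_preimageT => //; exact: ppX.1.
have mL n : measurable (large_increment (W n) T a).
  by apply: measurable_large_increment (ltW T0) _ => s s0; exact: (BX.2.1 n).1.
have q0 : 0 <= 4 * expR (- K) by rewrite mulr_ge0 ?expR_ge0.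
apply: (@le_trans _ _ (\sum_(n <oo) (4 * expR (- K))%:E * P (X n @^-1` A))%E).
  apply: (@le_trans _ _
      (\sum_(n <oo) P (X n @^-1` A `&` large_increment (W n) T a))%E).
    apply: measure_sigma_subadditive => //.
    - by move=> n; exact: measurableI.
    - exact: measurable_large_move (ltW T0) _.
  apply: lee_nneseries => // n _.
  (* Only two members of the independent family are used: the starting points ([None]) and the path
     [n]. *)
  have := BX.2.2 [:: None; Some n]
    (fun o => if o is Some m then large_increment (W m) T a else X n @^-1` A).
  rewrite bigcap_seq !big_cons !big_nil setIT mule1 => -> //.
    by rewrite [leRHS]muleC lee_wpmul2l//; exact: prob_large_increment (BX.2.1 n) T0 a0 K24.
  move=> o; rewrite !inE => /orP[/eqP ->|/eqP ->].
    by apply: sub_sigma_algebra; exists n, A.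
  by apply: (@gen_sigma_large_increment _ _ _ (W n)); exact: ltW.
rewrite nneseriesZl// [lam * _]mulrC [leRHS]EFinM lee_wpmul2l ?lee_fin//.
have := poisson_pp_mean_le ppX mA bA.
by rewrite A1/= mulr1; exact.
Qed.

(* Off this event, a particle starting at distance between [r + k] and [r + k + 1] from [y]
   moves by at most [(r + k) / 2] up to time [T], hence misses [y]. *)
Definition far_hit (T y r : R) : set Omega :=
  \bigcup_k (large_move `[y + r + k%:R, y + r + k%:R + 1[ T ((r + k%:R) / 8) `|`
             large_move `]y - r - k%:R - 1, y - r - k%:R] T ((r + k%:R) / 8)).

Lemma measurable_far_hit T y r : 0 <= T -> measurable (far_hit T y r).
Proof.
by move=> T0; apply: bigcup_measurable => k _; apply: measurableU; exact: measurable_large_move.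
Qed.

(** With [a = (r + k) / 8] the tail exponent of shell [k] is [alpha (r + k)^2]; the shells are then
    summed geometrically, with two sides each. *)
Lemma prob_far_hit T y r (alpha := (128 * T)^-1) :
  0 < T -> 1 <= r -> 24 <= alpha * r ->
  (P (far_hit T y r) <= (16 * lam * expR (- (alpha * r ^+ 2)))%:E)%E.
Proof.
move=> T0 r1 ar.
have al0 : 0 < alpha by rewrite invr_gt0; lra.
apply: measure_bigcup_geometric.
- by rewrite !mulr_ge0 ?expR_ge0 ?(ltW lam0).
- by move=> k; apply: measurableU; apply: measurable_large_move => //; exact: ltW.
move=> k; have k0 : 0 <= k%:R :> R by [].
have KE : ((r + k%:R) / 8) ^+ 2 / (2 * T) = alpha * (r + k%:R) ^+ 2.
  by rewrite /alpha; field; rewrite gt_eqF.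
have ark : 24 <= alpha * (r + k%:R) ^+ 2.
  by apply: le_trans ar _; rewrite ler_pM2l//; nra.
have bnd (A : set R) : measurable A -> bounded_real_set A -> (lebesgue_measure A = 1)%E ->
    (P (large_move A T ((r + k%:R) / 8)) <=
     (lam * (4 * expR (- (alpha * (r + k%:R) ^+ 2))))%:E)%E.
  move=> mA bA A1; rewrite -KE; apply: prob_large_move => //; last by rewrite KE.
  by rewrite divr_ge0//; lra.
apply: le_trans (measureU2 _ _ _) _; [exact: measurable_large_move (ltW T0) _..|].
apply: (@le_trans _ _ ((lam * (4 * expR (- (alpha * (r + k%:R) ^+ 2))))%:E +
   (lam * (4 * expR (- (alpha * (r + k%:R) ^+ 2))))%:E)%E).
  apply: leeD; apply: bnd => //.
  - exists (`|y + r + k%:R| + 1) => x /=; rewrite in_itv/= => /andP[x1 x2].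
    by rewrite ler_norml; have := ler_norm (y + r + k%:R);
      have := ler_norm (- (y + r + k%:R)); rewrite normrN; lra.
  - by rewrite lebesgue_measure_itv/= lte_fin ltrDl ltr01 -EFinB addrC addKr.
  - exists (`|y - r - k%:R| + 1) => x /=; rewrite in_itv/= => /andP[x1 x2].
    by rewrite ler_norml; have := ler_norm (y - r - k%:R);
      have := ler_norm (- (y - r - k%:R)); rewrite normrN; lra.
  - rewrite lebesgue_measure_itv/= lte_fin ifT; last by lra.
    by rewrite -EFinB; congr EFin; lra.
rewrite -EFinD lee_fin ler_pdivlMr ?ltr0n ?expn_gt0// natrX.
(* Here [alpha ((r + k)^2 - r^2) >= 2 alpha r k >= k], and [expR k >= 2^k]. *)
have : expR (- (alpha * (r + k%:R) ^+ 2)) <= expR (- (alpha * r ^+ 2)) / 2 ^+ k.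
  rewrite ler_pdivlMr ?exprn_gt0//.
  apply: (@le_trans _ _ (expR (- (alpha * (r + k%:R) ^+ 2)) * expR k%:R)).
    rewrite ler_wpM2l ?expR_ge0//.
    rewrite -[k%:R]mulr1 expRM_natl lerXn2r ?nnegrE ?expR_ge0//.
    by apply: le_trans (expR_ge1Dx _); lra.
  by rewrite -expRD ler_expR; nra.
rewrite ler_pdivlMr ?exprn_gt0// [2 ^+ k.+1]exprS => h.
have := ler_wpM2l (ltW lam0) h; lra.
Qed.

Lemma far_hit_uncovered T t y r w : 0 < T -> t <= T -> 0 < r ->
  (forall n, {within `[0, +oo[, continuous (fun s => W n s w)}) ->
  ~ far_hit T y r w -> (forall n, ~ `[y - r, y + r[%classic (X n w)) ->
  ~ occupied B t w y.
Proof.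
move=> T0 tT r0 cW nF nX [n [s [s0 st yE]]].
have W0 : W n 0 w = 0 by rewrite /W BX.1 subrr.
(* Chaining with [a = (r + k) / 8] bounds the displacement by [4 a = (r + k) / 2], less than the
   distance [r + k] to be covered. *)
have key (A : set R) (k : nat) : A (X n w) ->
    ~ large_move A T ((r + k%:R) / 8) w -> `|y - X n w| < r + k%:R.
  move=> AX nL; have k0 : 0 <= k%:R :> R by [].
  have nI : ~ large_increment (W n) T ((r + k%:R) / 8) w.
    by move=> h; apply: nL; exists n.
  have := not_large_increment_le T0 W0 (cW n) nI (s := s).
  rewrite s0 (le_trans st tT) {1}/W -yE => /(_ isT); lra.
have [xy|yx] := leP (y + r) (X n w).
  have h0 : 0 <= X n w - y - r by lra.
  have /andP[] := truncn_itv h0; set k := Num.truncn _ => k1; rewrite -natr1 => k2.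
  have : `|y - X n w| < r + k%:R.
    apply: (key `[y + r + k%:R, y + r + k%:R + 1[%classic k).
      by rewrite /= in_itv/=; lra.
    by move=> hL; apply: nF; exists k => //; left.
  by rewrite ltr_norml; lra.
have [xy|xy] := leP (y - r) (X n w).
  by apply: (nX n); rewrite /= in_itv/= xy.
have h0 : 0 <= y - r - X n w by lra.
have /andP[] := truncn_itv h0; set k := Num.truncn _ => k1; rewrite -natr1 => k2.
have : `|y - X n w| < r + k%:R.
  apply: (key `]y - r - k%:R - 1, y - r - k%:R]%classic k).
    by rewrite /= in_itv/=; lra.
  by move=> hL; apply: nF; exists k => //; right.
by rewrite ltr_norml; lra.
Qed.

(** The length [L] is chosen before the left end [c], so [c] may depend on [L]; this is what allows
    an interval lying wholly to the left of a given point. *)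
Lemma exists_uncovered (t eps : R) : 0 <= t -> 0 < eps ->
  exists L : R, forall c : R, exists F : set Omega,
    [/\ measurable F, (P F <= eps%:E)%E &
     forall w, (forall n, {within `[0, +oo[, continuous (fun s => W n s w)}) ->
       ~ F w -> exists2 y, c <= y <= c + L & ~ occupied B t w y].
Proof.
move=> t0 eps0; pose T := t + 1; have T0 : 0 < T by rewrite /T; lra.
pose alpha := (128 * T)^-1; have al0 : 0 < alpha by rewrite invr_gt0; lra.
(* The [N ~ exp ((2 lam + 1) r)] windows are many enough for one of them, each empty with
   probability [exp (- 2 lam r)], to be empty, and few enough for the union bound on the far
   hits, each of probability of order [exp (- alpha r^2)]. *)
pose r := 1 + (2 * lam + 26) / alpha + (1 + 32 * lam) / eps.
have r_al : 0 < (2 * lam + 26) / alpha by rewrite divr_gt0//; have := lam0; lra.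
have r_eps : 0 < (1 + 32 * lam) / eps by rewrite divr_gt0//; have := lam0; lra.
have r1 : 1 <= r by rewrite /r; lra.
(* The [26] serves twice: it gives [alpha r >= 24] for the far hits, and
   [(2 lam + 1) r - alpha r^2 <= - r], which beats the number of windows. *)
have ral : 2 * lam + 26 <= alpha * r.
  by rewrite [leRHS]mulrC -ler_pdivrMr// /r; lra.
have lr : 0 <= lam * r by rewrite mulr_ge0//; have := lam0; lra.
pose N := (Num.truncn (expR ((2 * lam + 1) * r))).+1.
have N1 : expR ((2 * lam + 1) * r) <= N%:R by exact/ltW/truncnS_gt.
have N2 : N%:R <= 2 * expR ((2 * lam + 1) * r).
  have := @truncn_le R (expR ((2 * lam + 1) * r)); rewrite expR_ge0 => h.
  have : 1 <= expR ((2 * lam + 1) * r).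
    by rewrite -[leLHS]expR0 ler_expR; lra.
  by rewrite /N -natr1; lra.
exists (2 * r * N%:R) => c.
pose y i := c + 2 * r * i%:R + r.
pose A i := `[y i - r, y i + r[%classic.
have mA i : measurable (A i) by exact: measurable_itv.
(* [F1]: no window is empty. [F2]: some centre may be reached from outside its window. *)
pose F1 := \bigcap_(i < N) ~` count_is X (A i) 0.
pose F2 := \big[setU/set0]_(i < N) far_hit T (y i) r.
have mF1 : measurable F1.
  apply: bigcap_measurable; first by exists 0%N.
  by move=> i _; apply: measurableC; apply: measurable_count_is (mA i) => n; exact: ppX.1.
have mF2 : measurable F2.
  by apply: bigsetU_measurable => i _; exact: measurable_far_hit (ltW T0).
exists (F1 `|` F2); split; first exact: measurableU.
- apply: le_trans (measureU2 _ _ _) _ => //.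
  have PF1 : P F1 = ((1 - expR (- (2 * lam * r))) ^+ N)%:E.
    apply: (poisson_pp_no_empty ppX) => //.
    + move=> i; exists (`|y i| + r) => x; rewrite /A/= in_itv/= => /andP[x1 x2].
      by rewrite ler_norml; have := ler_norm (y i);
        have := ler_norm (- y i); rewrite normrN; lra.
    + move=> i j ij; apply/seteqP; split => // x []; rewrite /A/= !in_itv/= /y.
      move=> /andP[i1 i2] /andP[j1 j2]; exfalso.
      wlog lij : i j ij i1 i2 j1 j2 / (i < j)%N.
        move=> wl; have [h|h|h] := ltngtP i j; last by rewrite h eqxx in ij.
          exact: (wl i j).
        by apply: (wl j i) => //; rewrite eq_sym.
      have : i.+1%:R <= j%:R :> R by rewrite ler_nat.
      rewrite -natr1 => h; nra.
    + move=> i; rewrite /A lebesgue_measure_itv/= lte_fin ifT; last by lra.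
      by rewrite -EFinB/=; congr expR; lra.
  have PF2 : (P F2 <= (N%:R * (16 * lam * expR (- (alpha * r ^+ 2))))%:E)%E.
    apply: le_trans (Boole_inequality P (fun i _ => measurable_far_hit (y i) r (ltW T0))) _.
    apply: (@le_trans _ _ (\sum_(i < N) (16 * lam * expR (- (alpha * r ^+ 2)))%:E)%E).
      apply: lee_sum => i _; apply: prob_far_hit => //.
      by apply: le_trans ral; have := lam0; lra.
    by rewrite sumEFin sumr_const card_ord [N%:R * _]mulr_natl.
  apply: le_trans (leeD (_ : P F1 <= _)%E PF2) _; first by rewrite PF1.
  rewrite -EFinD lee_fin.
  have rE : r <= expR r by apply: le_trans (expR_ge1Dx _); lra.
  (* Use [1 - p <= expR (- p)] with [N p >= expR r >= r]. *)
  have h1 : (1 - expR (- (2 * lam * r))) ^+ N <= expR (- r).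
    apply: (@le_trans _ _ (expR (- expR (- (2 * lam * r))) ^+ N)).
      rewrite lerXn2r ?nnegrE ?expR_ge0 ?subr_ge0 ?expR_ge1Dx//.
      by rewrite -[leRHS]expR0 ler_expR; lra.
    rewrite -expRM_natl ler_expR mulrN lerN2; apply: le_trans rE _.
    apply: (@le_trans _ _ (expR ((2 * lam + 1) * r) * expR (- (2 * lam * r)))).
      by rewrite -expRD ler_expR; lra.
    by rewrite ler_wpM2r ?expR_ge0.
  have h2 : N%:R * expR (- (alpha * r ^+ 2)) <= 2 * expR (- r).
    apply: (@le_trans _ _ (2 * expR ((2 * lam + 1) * r) * expR (- (alpha * r ^+ 2)))).
      by rewrite ler_wpM2r ?expR_ge0.
    by rewrite -mulrA -expRD ler_wpM2l// ler_expR; nra.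
  (* [F1] contributes [1] and [F2] contributes [16 lam * 2], both times [expR (- r) <= 1 / r]. *)
  have h3 : (1 + 32 * lam) * expR (- r) <= eps.
    rewrite expRN ler_pdivrMr ?expR_gt0// [leRHS]mulrC -ler_pdivrMr//.
    by apply: le_trans rE; rewrite /r; lra.
  have := ler_wpM2l (ltW lam0) h2; lra.
move=> w cW nF.
have [i iN Ei] : exists2 i, (i < N)%N & count_is X (A i) 0 w.
  apply: contrapT => h; apply: nF; left => i iN Ei; apply: h.
  by exists i.
have [iR0 iR1] : 0 <= i%:R :> R /\ i%:R + 1 <= N%:R :> R.
  by split => //; rewrite natr1 ler_nat.
exists (y i).
  rewrite /y; nra.
have [s [_ /size0nil s0 hs]] := Ei.
apply: (@far_hit_uncovered T t (y i) r w) => //.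
- by rewrite /T; lra.
- by lra.
- by move=> h; apply: nF; right; rewrite /F2 -(bigcup_mkord N (fun i => far_hit T (y i) r)); exists i.
- by move=> n /hs; rewrite s0.
Qed.

End uncovered_points.

(** * Clusters on the line *)

(** By the intermediate value theorem, a path in the line visits every point between its ends. *)
Lemma path_connected_between {R : realType} (C : set R) (a b y : R) :
  path_connected_set C -> C a -> C b -> Num.min a b <= y <= Num.max a b -> C y.
Proof.
move=> pC Ca Cb yab; have [g [cg g0 g1 gC]] := pC a b Ca Cb.
have [|u + <-] := IVT (@ler01 R) cg (v := y); first by rewrite g0 g1.
by rewrite in_itv/= => /gC.
Qed.

Lemma cluster_bounded {R : realType} (A C : set R) : cluster_of A C ->
  (forall m : nat, exists2 y, m%:R <= y & ~ A y) ->
  (forall m : nat, exists2 y, y <= - m%:R & ~ A y) -> bounded_cluster C.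
Proof.
move=> [CA pC _] right left.
(* The empty set is a cluster when [A] is empty. *)
have [[c Cc]|nC] := pselect (exists c, C c); last first.
  by exists 0 => y Cy; exfalso; apply: nC; exists y.
pose m := (Num.truncn `|c|).+1.
have cm : `|c| < m%:R by exact: truncnS_gt.
have [u mu nu] := right m; have [v mv nv] := left m.
have [c1 c2] : v <= c /\ c <= u by move: cm; rewrite ltr_norml; lra.
exists (`|u| + `|v| + 1) => y Cy.
have uE := ler_norm u; have vE := ler_norm (- v); rewrite normrN in vE.
have u0 := normr_ge0 u; have v0 := normr_ge0 v.
rewrite ltr_norml; apply/andP; split.
  rewrite ltNge; apply/negP => yv; apply: nv; apply: CA.
  apply: (path_connected_between pC Cy Cc).
  by rewrite ge_min le_max c1 orbT andbT; apply/orP; left; lra.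
rewrite ltNge; apply/negP => yv; apply: nu; apply: CA.
apply: (path_connected_between pC Cc Cy).
by rewrite ge_min le_max c2 /=; apply/orP; right; lra.
Qed.

(** * From small exceptional events to an almost sure statement *)

(** Covers of measure at most [1 / (k+1)] intersect in a measurable null cover. Measurability of [A]
    itself is not assumed, which suits events quantifying over all real points. *)
Lemma negligible_small d (T : measurableType d) (R : realType)
    (mu : {measure set T -> \bar R}) (A : set T) :
  (forall eps, 0 < eps -> exists F, [/\ measurable F, (mu F <= eps%:E)%E & A `<=` F]) ->
  mu.-negligible A.
Proof.
move=> h; have /choice[F hF] (k : nat) : exists F : set T,
    [/\ measurable F, (mu F <= (k.+1%:R^-1)%:E)%E & A `<=` F].
  by apply: h; rewrite invr_gt0.
exists (\bigcap_k F k); split.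
- by apply: bigcap_measurable; [exists 0%N|move=> k _; case: (hF k)].
- apply/eqP; rewrite -measure_le0; apply/lee_addgt0Pr => e e0; rewrite add0e.
  have [k ke] : exists k : nat, k.+1%:R^-1 <= e.
    exists (Num.truncn e^-1); rewrite -[leRHS]invrK lef_pV2 ?posrE ?invr_gt0//.
    exact/ltW/truncnS_gt.
  have [mFk muFk _] := hF k.
  apply: (@le_trans _ _ (mu (F k))).
    apply: le_measure; rewrite ?inE//; last by move=> w; exact.
    by apply: bigcap_measurable; [exists 0%N|move=> j _; case: (hF j)].
  by apply: le_trans muFk _; rewrite lee_fin.
- by move=> w Aw k _; have [_ _] := hF k; exact.
Qed.

Unset Implicit Arguments.

Theorem theorem1p1 (R : realType) (d : measure_display) (Omega : measurableType d)
  (P : probability Omega R) (lam : R) (X : nat -> Omega -> R)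
  (B : nat -> R -> Omega -> R) :
  0 < lam -> poisson_pp P lam X -> BM_from_points P X B ->
  forall t : R, 0 <= t ->
  {ae P, forall w, forall C, cluster_of (occupied B t w) C -> bounded_cluster C}.
Proof.
move=> lam0 ppX BX t t0.
pose cont w := forall n, {within `[0, +oo[, continuous (fun s => B n s w - X n w)}.
have ae_cont : {ae P, forall w, cont w}.
  by apply: ae_foralln => n; exact: (BX.2.1 n).2.2.1.
(* [c0] places the interval once [L] is known: at [m] for the right side, at [- m - L] for the left.
   Continuity stays a premise, so that the exceptional sets only have to contain continuous
   outcomes. *)
have uncovered (c0 : R -> R) (Q : R -> Prop) :
    (forall L y, c0 L <= y <= c0 L + L -> Q y) ->
    {ae P, forall w, cont w -> exists2 y, Q y & ~ occupied B t w y}.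
  move=> cQ; apply: negligible_small => eps eps0.
  have [L /(_ (c0 L))[F [mF PF hF]]] := exists_uncovered lam0 ppX BX t0 eps0.
  exists F; split => // w; apply: contra_notP => nF cw.
  by have [y /cQ Qy ny] := hF w cw nF; exists y.
have ae_right : {ae P, forall w, forall m : nat, cont w ->
    exists2 y, m%:R <= y & ~ occupied B t w y}.
  apply: ae_foralln => m; apply: (uncovered (fun=> m%:R)) => L y /andP[//].
have ae_left : {ae P, forall w, forall m : nat, cont w ->
    exists2 y, y <= - m%:R & ~ occupied B t w y}.
  apply: ae_foralln => m; apply: (uncovered (fun L => - m%:R - L)) => L y /andP[_].
  by rewrite subrK.
apply: filterS3 ae_cont ae_right ae_left => w cw hr hl C hC.
by apply: (cluster_bounded hC) => m; [exact: hr|exact: hl].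
Qed.
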